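(* Let $P\in\Psi^m_{\mathrm{phg}}(X;E)$ be of real principal type and endowed with the Hamilton field $H=H_q$ on $\operatorname{Char}P$. Denote by $p+\hslash p_1$ the leading symbol of $P$, and let $\tilde p=qp^{-1}$ (extended smoothly across $\operatorname{Char} P$), so that $\tilde p p=q\,\mathrm{Id}$. Set $$p_s=\tilde p\,p_1-i\,\mathcal V\tilde p\cdot\mathcal H p+\tfrac{i}{2}(\mathcal V\cdot\mathcal H q)\,\mathrm{Id}.$$ Then the restriction $p_s|_{\ker p}$ (at points of $\operatorname{Char}P$) does not depend on the choice of the function $q$ with $H_q=H$ on $\operatorname{Char}P$.
   Context: Geometry. $X$ is a smooth manifold (Hausdorff, second countable, no boundary) with a symmetric (torsion-free) linear connection $\nabla$; $\pi:T^*X\to X$; $E\to X$ is a complex vector bundle with linear connection $\nabla^E$; $\operatorname{End}(E)$ has the induced connection. In canonical coordinates $(x^j,\xi_j)$ put $\partial_j=\partial/\partial x^j$, $\partial^j=\partial/\partial\xi_j$; $\Gamma^i_{kj}$ are the Christoffel symbols. For a section $a$ of $\pi^*F$ over $T^*X$ ($F$ a bundle with connection) the vertical derivative is $\mathcal Va=\partial_j\otimes\partial^ja$, a section of $\pi^*(TX\otimes F)$. The horizontal derivative $\mathcal Ha$ is a section of $\pi^*(T^*X\otimes F)$: for scalar $a$, $\mathcal Ha=(\partial_ka+\Gamma^j_{km}\xi_j\partial^ma)\,dx^k$; for $a=a^je_j$ in a local frame with $\nabla^Fe_k=\omega^j_ke_j$, $\mathcal Ha=(\mathcal Ha^j+a^k\omega^j_k)e_j$.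 A centered dot is contraction of $T^*X\otimes TX$ factors (combined with composition of endomorphisms). Leading symbol. For $x\in X$ and $y=\exp_xv$ let $\tau^E_{x\leftarrow y}$ be parallel transport along the geodesic from $y$ to $x$. The geometric quantization of a symbol $a\in S^m(T^*X;\operatorname{End}(E))$ is $\operatorname{Op}(a)u(x)=(2\pi)^{-\dim X}\int_{T_x^*X}\int_{T_xX}e^{-i\xi v}a(x,\xi)\tau^E_{x\leftarrow y}u(y)\chi(x,y)\,dv\,d\xi$, with $\chi$ a properly supported smooth cutoff equal to $1$ near the diagonal and supported close to it. Every $P\in\Psi^m_{\mathrm{phg}}(X;E)$ equals $\operatorname{Op}(a)$ modulo a smoothing operator with $a\sim\sum_{j\ge0}p_j$, $p_j$ homogeneous of degree $m-j$ in $\xi$. The leading symbol of $P$ is $p_0+\hslash p_1$ ($\hslash$ is only a bookkeeping symbol); $p=p_0$ is the principal symbol. Real principal type. $\operatorname{Char}P=\{\det p=0\}\setminus0\subset T^*X\setminus0$. $P$ is of real principal type iff (i) $\operatorname{Char}P$ is a smooth hypersurface with a non-radial Hamilton field $H$, homogeneous of degree zero; (ii) locally on $\operatorname{Char}P$, $\dim\ker p$ is constant; (iii) if $q$ is a defining function of $\operatorname{Char}P$, then $\tilde p=qp^{-1}$ extends smoothly across $\operatorname{Char}P$. $P$ is ''endowed with $H$'' if such an $H$ is fixed; the functions $q$ considered are real-valued defining functions of $\operatorname{Char}P$, homogeneous of degree $1$ in $\xi$, with Hamilton field $H_q=H$ on $\operatorname{Char}P$; they are determined up to a factor equal to $1$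 on $\operatorname{Char}P$. Here $H_q=(\partial^jq)\partial_j-(\partial_jq)\partial^j$. *)

(* Defs.v *)
From HB Require Import structures.
From mathcomp Require Import all_boot all_order all_algebra.
From mathcomp Require Import all_classical all_reals all_analysis.
From mathcomp Require Import complex.

Set Implicit Arguments.
Unset Strict Implicit.
Unset Printing Implicit Defensive.

Import Order.TTheory GRing.Theory Num.Theory.
Import numFieldNormedType.Exports.

Local Open Scope classical_set_scope.
Local Open Scope ring_scope.
Local Open Scope complex_scope.

Section Calculus.
Context {R : realType}.

Definition iterD {V : normedModType R} (vs : seq V) (f : V -> R) : V -> R :=
  foldr (fun v g x => 'D_v g x) f vs.

(* Smoothness on a set [A], which is open in every use: all iterated
   directional derivatives exist and are continuous at the points of [A]. *)
Definition smooth_on {V : normedModType R} (A : set V) (f : V -> R) : Prop :=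
  forall (vs : seq V) (v x : V), A x ->
    derivable (iterD vs f) x v /\ {for x, continuous (iterD vs f)}.

Definition entrywise {V : Type} {k l : nat} (Q : (V -> R) -> Prop)
    (f : V -> 'M[R[i]]_(k, l)) : Prop :=
  forall a b, Q (fun z => complex.Re (f z a b)) /\
              Q (fun z => complex.Im (f z a b)).

Definition mxD {V : normedModType R} {k l : nat} (v : V)
    (f : V -> 'M[R[i]]_(k, l)) (z : V) : 'M[R[i]]_(k, l) :=
  \matrix_(a, b) ('D_v (fun z => complex.Re (f z a b)) z +i*
                  'D_v (fun z => complex.Im (f z a b)) z).

(* The integral over R^n as an iterated one-dimensional Lebesgue integral. *)
Fixpoint rVint (n : nat) : ('rV[R]_n -> R) -> R :=
  match n with
  | 0 => fun f => f 0
  | n'.+1 => fun f =>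
      \int[@lebesgue_measure R]_(t in setT)
        rVint (fun v : 'rV[R]_n' => f (row_mx (t%:M : 'rV[R]_1) v))
  end.

Definition mxint {n k l : nat} (f : 'rV[R]_n -> 'M[R[i]]_(k, l)) :
    'M[R[i]]_(k, l) :=
  \matrix_(a, b) (rVint (fun v => complex.Re (f v a b)) +i*
                  rVint (fun v => complex.Im (f v a b))).

Definition ebase {n : nat} (k : 'I_n) : 'rV[R]_n := delta_mx 0 k.

(* The directions of d/dx^k and d/dxi_k in coordinates (x, xi). *)
Definition xdir {n : nat} (k : 'I_n) : 'rV[R]_n * 'rV[R]_n := (ebase k, 0).
Definition xidir {n : nat} (k : 'I_n) : 'rV[R]_n * 'rV[R]_n := (0, ebase k).

End Calculus.

(* [pnt i] is the inverse of the chart [crd i]; only its values on the image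
   of the chart matter. *)
Record manifold (R : realType) (n : nat) := Manifold {
  point :> topologicalType;
  chart : Type;
  dom : chart -> set point;
  crd : chart -> point -> 'rV[R]_n;
  pnt : chart -> 'rV[R]_n -> point;
  point_hausdorff : hausdorff_space point;
  point_second_countable : @second_countable point;
  dom_open : forall i, open (dom i);
  dom_cover : forall x, exists i, dom i x;
  crd_img_open : forall i, open (crd i @` dom i);
  crdK : forall i x, dom i x -> pnt i (crd i x) = x;
  crd_continuous : forall i x, dom i x -> {for x, continuous (crd i)};
  pnt_continuous : forall i y, (crd i @` dom i) y ->
    {for y, continuous (pnt i)};
  transition_smooth : forall i j k,
    smooth_on (crd i @` (dom i `&` dom j)) (fun y => crd j (pnt i y) 0 k)
}.

Section Cotangent.
Context {R : realType} {n : nat} {X : manifold R n}.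

Definition img (i : chart X) : set 'rV[R]_n := crd i @` dom i.

(* d x_i^d / d x_j^a at [x], for the coordinates x_i, x_j of charts i, j. *)
Definition jac (i j : chart X) (x : X) (a d : 'I_n) : R :=
  'D_(ebase a) (fun y => crd i (pnt j y) 0 d) (crd j x).

(* A tangent or cotangent vector at [x] is the family of its components in
   the charts around [x].  Functions on T^*X are only ever evaluated at the
   genuine covectors [cov i z]. *)
Definition tangent : Type := chart X -> 'rV[R]_n.
Definition cotangent : Type := chart X -> 'rV[R]_n.

(* The covector with canonical coordinates [z = (x, xi)] in chart [i]; its
   components in chart [k] are given by the covector transformation law, and
   put to 0 when [k] is not a chart around the base point. *)
Definition cov (i : chart X) (z : 'rV[R]_n * 'rV[R]_n) : cotangent :=
  fun k =>
    if `[< dom k (pnt i z.1) >]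
    then \row_a \sum_d z.2 0 d * jac i k (pnt i z.1) a d
    else 0.

Definition loc {T : Type} (i : chart X) (f : X -> cotangent -> T)
    (z : 'rV[R]_n * 'rV[R]_n) : T := f (pnt i z.1) (cov i z).

(* The part of T^*X \ 0 lying in a set [O] of covectors, in chart [i]. *)
Definition cdom (O : X -> cotangent -> Prop) (i : chart X) :
    set ('rV[R]_n * 'rV[R]_n) :=
  [set z | [/\ img i z.1, z.2 != 0 & loc i O z]].

Definition copen (O : X -> cotangent -> Prop) : Prop :=
  forall i, open (cdom O i).

Definition everywhere : X -> cotangent -> Prop := fun _ _ => True.

End Cotangent.

Arguments tangent {R n} X.
Arguments cotangent {R n} X.
Arguments everywhere {R n} X.

(* [chr i y a b c] is the Christoffel symbol Gamma^a_{bc} in chart [i]. *)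
Record connection (R : realType) (n : nat) (X : manifold R n) := Connection {
  chr : chart X -> 'rV[R]_n -> 'I_n -> 'I_n -> 'I_n -> R;
  chr_smooth : forall i a b c, smooth_on (img i) (fun y => chr i y a b c);
  chr_sym : forall i y a b c, img i y -> chr i y a b c = chr i y a c b;
  chr_transition : forall i j x b c d, dom i x -> dom j x ->
    \sum_a chr j (crd j x) a b c * jac i j x a d =
    'D_(ebase b) (fun y =>
       'D_(ebase c) (fun y' => crd i (pnt j y') 0 d) y) (crd j x)
    + \sum_e \sum_f chr i (crd i x) d e f * jac i j x b e * jac i j x c f
}.

(* A complex vector bundle of rank [N]: its fibres, and local frames indexed
   by [triv] with smooth transition coefficients. *)
Record bundle (R : realType) (n : nat) (X : manifold R n) (N : nat) := Bundle {
  fib : X -> vectType R[i];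
  triv : Type;
  tdom : triv -> set X;
  frame : triv -> forall x : X, N.-tuple (fib x);
  tdom_open : forall j, open (tdom j);
  tdom_cover : forall x, exists j, tdom j x;
  frame_basis : forall j x, tdom j x -> basis_of fullv (frame j x);
  frame_smooth : forall i j j',
    entrywise (smooth_on (crd i @` (dom i `&` (tdom j `&` tdom j'))))
      (fun y => \matrix_(k, l)
         coord (frame j (pnt i y)) k (tnth (frame j' (pnt i y)) l))
}.

Section Bundle.
Context {R : realType} {n N : nat} {X : manifold R n} {E : bundle X N}.

Definition timg (i : chart X) (j : triv E) : set 'rV[R]_n :=
  crd i @` (dom i `&` tdom j).

Definition fcrd (j : triv E) (x : X) (w : fib E x) : 'cV[R[i]]_N :=
  \col_k coord (frame j x) k w.

Definition fmx (j : triv E) (x : X) (f : 'End(fib E x)) : 'M[R[i]]_N :=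
  \matrix_(k, l) coord (frame j x) k (f (tnth (frame j x) l)).

(* Column [l] gives the frame [j'] in terms of the frame [j]. *)
Definition gmx (j j' : triv E) (x : X) : 'M[R[i]]_N :=
  \matrix_(k, l) coord (frame j x) k (tnth (frame j' x) l).

End Bundle.

(* [frm i j y k] is the connection matrix in direction d/dx^k of chart [i]
   with respect to frame [j]: its column [l] is the derivative of the [l]-th
   frame element. *)
Record bconnection (R : realType) (n N : nat) (X : manifold R n)
    (E : bundle X N) := BConnection {
  frm : chart X -> triv E -> 'rV[R]_n -> 'I_n -> 'M[R[i]]_N;
  frm_smooth : forall i j k,
    entrywise (smooth_on (timg i j)) (fun y => frm i j y k);
  frm_chart : forall i i' j x k, dom i x -> dom i' x -> tdom j x ->
    frm i' j (crd i' x) k =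
    \sum_a (jac i i' x k a)%:C *: frm i j (crd i x) a;
  frm_frame : forall i j j' x k, dom i x -> tdom j x -> tdom j' x ->
    gmx j j' x *m frm i j' (crd i x) k =
    mxD (ebase k) (fun y => gmx j j' (pnt i y)) (crd i x)
    + frm i j (crd i x) k *m gmx j j' x
}.

Section Transport.
Context {R : realType} {n N : nat} {X : manifold R n} {E : bundle X N}.
Variables (nabla : connection X) (nablaE : bconnection E).

Definition ccomp (i : chart X) (g : R -> X) (a : 'I_n) : R -> R :=
  fun t => crd i (g t) 0 a.

(* Geodesics on an open interval containing [0, 1]. *)
Definition geodesic (e : R) (g : R -> X) : Prop :=
  forall t : R, - e < t < 1 + e ->
    {for t, continuous g} /\
    forall i a, dom i (g t) ->
      [/\ derivable (ccomp i g a) t 1,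
          derivable (derive1 (ccomp i g a)) t 1 &
          derive1 (derive1 (ccomp i g a)) t =
          - \sum_b \sum_c chr nabla i (crd i (g t)) a b c
                          * derive1 (ccomp i g b) t * derive1 (ccomp i g c) t].

Definition initial_velocity (g : R -> X) (v : tangent X) : Prop :=
  forall i a, dom i (g 0) -> derive1 (ccomp i g a) 0 = v i 0 a.

Definition parallel (e : R) (g : R -> X) (s : forall t, fib E (g t)) : Prop :=
  forall t : R, - e < t < 1 + e ->
    forall i j, dom i (g t) -> tdom j (g t) ->
      entrywise (fun f => derivable f t 1) (fun r => fcrd j (s r)) /\
      mxD (1 : R) (fun r => fcrd j (s r)) t =
      - \sum_k (derive1 (ccomp i g k) t)%:C *:
           (frm nablaE i j (crd i (g t)) k *m fcrd j (s t)).

(* [lg x y] is the inverse of exp_x, on a neighbourhood [W] of the diagonal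
   over which exp is a diffeomorphism from a fibrewise star-shaped
   neighbourhood of the zero section of TX. *)
Definition exp_inverse (W : set (X * X)) (lg : X -> X -> tangent X) : Prop :=
  [/\ open W,
      forall x, W (x, x),
      forall i k a,
        smooth_on [set z : 'rV[R]_n * 'rV[R]_n |
                    [/\ img i z.1, img k z.2 & W (pnt i z.1, pnt k z.2)]]
          (fun z => lg (pnt i z.1) (pnt k z.2) i 0 a) &
      forall x y, W (x, y) -> exists e g,
        [/\ 0 < e, geodesic e g, g 0 = x, g 1 = y &
            initial_velocity g (lg x y) /\
            forall t : R, 0 <= t <= 1 ->
              W (x, g t) /\
              forall i, dom i x -> lg x (g t) i = t *: lg x y i]].

Definition csupp (chi : X -> X -> R) : set (X * X) :=
  closure [set z | chi z.1 z.2 != 0].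

Definition cutoff (W : set (X * X)) (chi : X -> X -> R) : Prop :=
  [/\ forall i k,
        smooth_on [set z : 'rV[R]_n * 'rV[R]_n | img i z.1 /\ img k z.2]
          (fun z => chi (pnt i z.1) (pnt k z.2)),
      forall x : X, \forall z \near (x, x), chi z.1 z.2 = 1,
      csupp chi `<=` W &
      forall K : set X, compact K ->
        compact (csupp chi `&` (K `*` setT)) /\
        compact (csupp chi `&` (setT `*` K))].

Definition tsection : Type := forall x : X, fib E x.

Definition smooth_section (u : tsection) : Prop :=
  forall i j, entrywise (smooth_on (timg i j))
                (fun y => fcrd j (u (pnt i y))).

Definition supp (u : tsection) : set X := closure [set x | u x != 0].

(* The coordinates in frame [j] of chi(x, y) tau_{x <- y} u(y), y = exp_x v,
   as a function of the components [v] of the tangent vector in chart [i];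
   it is 0 unless y lies over the neighbourhood [W]. *)
Definition pullback (W : set (X * X)) (lg : X -> X -> tangent X)
    (chi : X -> X -> R) (u : tsection) (i : chart X) (j : triv E) (x : X)
    (v : 'rV[R]_n) : 'cV[R[i]]_N :=
  xget 0 [set c : 'cV[R[i]]_N |
    exists (e : R) (g : R -> X) (s : forall t, fib E (g t)),
      [/\ 0 < e, geodesic e g, parallel e s, s 1 = u (g 1) &
          [/\ g 0 = x, W (x, g 1), lg x (g 1) i = v,
              initial_velocity g (lg x (g 1)) &
              c = (chi x (g 1))%:C *: fcrd j (s 0)]]].

End Transport.

Arguments tsection {R n N X} E.

Section Operators.
Context {R : realType} {n N : nat} {X : manifold R n} {E : bundle X N}.
Variables (nabla : connection X) (nablaE : bconnection E).

(* Sections of pi^* End(E). *)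
Definition symbol : Type := forall x : X, cotangent X -> 'End(fib E x).

Definition lsym (a : symbol) (i : chart X) (j : triv E)
    (z : 'rV[R]_n * 'rV[R]_n) : 'M[R[i]]_N :=
  fmx j (a (pnt i z.1) (cov i z)).

Definition mixed (al be : seq 'I_n) : seq ('rV[R]_n * 'rV[R]_n) :=
  map xdir al ++ map xidir be.

Definition symbol_class (m : R) (a : symbol) : Prop :=
  forall i j,
    entrywise (smooth_on [set z | timg i j z.1]) (lsym a i j) /\
    forall (al be : seq 'I_n) (K : set 'rV[R]_n),
      compact K -> K `<=` timg i j ->
      exists C : R, forall z : 'rV[R]_n * 'rV[R]_n, K z.1 ->
        entrywise (fun f => `|iterD (mixed al be) f z| <=
                            C * (1 + `|z.2|) `^ (m - (size be)%:R))
          (lsym a i j).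

Definition symbol_smooth_on (O : X -> cotangent X -> Prop) (a : symbol) : Prop :=
  forall i j,
    entrywise (smooth_on [set z | cdom O i z /\ timg i j z.1]) (lsym a i j).

Definition symbol_homogeneous (d : R) (a : symbol) : Prop :=
  forall i z (t : R), img i z.1 -> z.2 != 0 -> 0 < t ->
    a (pnt i z.1) (cov i (z.1, t *: z.2)) =
    (t `^ d)%:C *: a (pnt i z.1) (cov i z).

(* a ~ sum_j ps_j: after excising a neighbourhood of the zero section,
   a - sum_(j < k) ps_j is a symbol of order m - k for every k. *)
Definition asymptotic (m : R) (a : symbol) (ps : nat -> symbol) : Prop :=
  forall (k : nat) i j (al be : seq 'I_n) (K : set 'rV[R]_n),
    compact K -> K `<=` timg i j ->
    exists C : R, forall z : 'rV[R]_n * 'rV[R]_n, K z.1 -> 1 <= `|z.2| ->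
      entrywise (fun f => `|iterD (mixed al be) f z| <=
                          C * `|z.2| `^ (m - k%:R - (size be)%:R))
        (fun z => lsym a i j z - \sum_(r < k) lsym (ps r) i j z).

(* The coordinates in frame [j] of Op(a)u(x), computed in chart [i]. *)
Definition Op (W : set (X * X)) (lg : X -> X -> tangent X)
    (chi : X -> X -> R) (a : symbol) (u : tsection E)
    (i : chart X) (j : triv E) (x : X) : 'cV[R[i]]_N :=
  (((2 * pi) ^+ n)^-1)%:C *:
  mxint (fun xi : 'rV[R]_n =>
    mxint (fun v : 'rV[R]_n =>
      let th := \sum_k xi 0 k * v 0 k in
      (cos th -i* sin th) *:
      (lsym a i j (crd i x, xi)
       *m pullback nabla nablaE W lg chi u i j x v))).

Definition test_section (u : tsection E) : Prop :=
  smooth_section u /\ compact (supp u).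

Definition linear_operator (P : tsection E -> tsection E) : Prop :=
  (forall u, test_section u -> smooth_section (P u)) /\
  (forall (c : R[i]) u v, test_section u -> test_section v ->
     forall x, P (fun x' => c *: u x' + v x') x = c *: P u x + P v x).

(* P - Op(a) has a smooth kernel; it suffices to say so on sections supported
   in a single chart and frame, both operators being linear. *)
Definition smoothing_difference (P : tsection E -> tsection E)
    (Q : tsection E -> chart X -> triv E -> X -> 'cV[R[i]]_N) : Prop :=
  forall (i k : chart X) (j l : triv E),
    exists kap : 'rV[R]_n * 'rV[R]_n -> 'M[R[i]]_N,
      entrywise (smooth_on [set z | timg i j z.1 /\ timg k l z.2]) kap /\
      forall u x, test_section u -> supp u `<=` dom k `&` tdom l ->
        dom i x -> tdom j x ->
        fcrd j (P u x) - Q u i j x =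
        mxint (fun y => if `[< timg k l y >]
                        then kap (crd i x, y) *m fcrd l (u (pnt k y))
                        else 0).

(* P = Op(a) modulo a smoothing operator, with a ~ sum_j ps_j and ps_j
   homogeneous of degree m - j. *)
Definition full_symbol (m : R) (P : tsection E -> tsection E)
    (ps : nat -> symbol) : Prop :=
  (forall r, symbol_smooth_on (everywhere X) (ps r) /\
             symbol_homogeneous (m - r%:R) (ps r)) /\
  exists (a : symbol) W lg chi,
    [/\ symbol_class m a, asymptotic m a ps, exp_inverse nabla W lg,
        cutoff W chi & smoothing_difference P (Op W lg chi a)].

Definition Psi_phg (m : R) (P : tsection E -> tsection E) : Prop :=
  linear_operator P /\ exists ps, full_symbol m P ps.

Definition leading_symbol (m : R) (P : tsection E -> tsection E)
    (p p1 : symbol) : Prop :=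
  exists ps, [/\ full_symbol m P ps, ps 0%N = p & ps 1%N = p1].

Definition dx (q : X -> cotangent X -> R) i (k : 'I_n) z : R :=
  'D_(xdir k) (loc i q) z.
Definition dxi (q : X -> cotangent X -> R) i (k : 'I_n) z : R :=
  'D_(xidir k) (loc i q) z.

Definition hor (q : X -> cotangent X -> R) i (k : 'I_n) z : R :=
  dx q i k z
  + \sum_j \sum_m chr nabla i z.1 j k m * z.2 0 j * dxi q i m z.

(* The contraction V . H q: [hor q] is a section of pi^* T^*X, whose vertical
   derivative is taken componentwise. *)
Definition verhor (q : X -> cotangent X -> R) i z : R :=
  \sum_k 'D_(xidir k) (hor q i k) z.

(* The last summand is the action of the induced connection of End(E). *)
Definition horE (a : symbol) i j (k : 'I_n) z : 'M[R[i]]_N :=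
  mxD (xdir k) (lsym a i j) z
  + (\sum_l \sum_m (chr nabla i z.1 l k m * z.2 0 l)%:C *:
                     mxD (xidir m) (lsym a i j) z)
  + (frm nablaE i j z.1 k *m lsym a i j z
     - lsym a i j z *m frm nablaE i j z.1 k).

Definition imC : R[i] := 0 +i* 1.

(* p_s = pt p1 - i V pt . H p + (i/2) (V . H q) Id, in chart i, frame j. *)
Definition subprincipal (p p1 : symbol) (q : X -> cotangent X -> R)
    (pt : symbol) i j z : 'M[R[i]]_N :=
  lsym pt i j z *m lsym p1 i j z
  - imC *: (\sum_k mxD (xidir k) (lsym pt i j) z *m horE p i j k z)
  + (imC / 2%:R * (verhor q i z)%:C)%:M.

Definition detE (x : X) (f : 'End(fib E x)) : R[i] :=
  \det (passmx.mxof (vbasis {:fib E x}) (vbasis {:fib E x}) f).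

Definition Char (p : symbol) (i : chart X) : set ('rV[R]_n * 'rV[R]_n) :=
  [set z | [/\ img i z.1, z.2 != 0 &
               detE (p (pnt i z.1) (cov i z)) = 0]].

(* [q] is a real-valued defining function of Char P in the open subset [O]
   of T^*X \ 0. *)
Definition defining (p : symbol) (O : X -> cotangent X -> Prop)
    (q : X -> cotangent X -> R) : Prop :=
  forall i,
    smooth_on (cdom O i) (loc i q) /\
    forall z, cdom O i z ->
      (loc i q z = 0 <-> Char p i z) /\
      (Char p i z -> exists v, 'D_v (loc i q) z != 0).

(* H_q = (d^j q) d_j - (d_j q) d^j. *)
Definition Ham (q : X -> cotangent X -> R) (i : chart X)
    (z : 'rV[R]_n * 'rV[R]_n) : 'rV[R]_n * 'rV[R]_n :=
  (\row_k dxi q i k z, - \row_k dx q i k z).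

(* Vector fields along Char P, in canonical coordinates. *)
Definition cfield : Type :=
  chart X -> 'rV[R]_n * 'rV[R]_n -> 'rV[R]_n * 'rV[R]_n.

Definition Ham_on_Char (p : symbol) (O : X -> cotangent X -> Prop)
    (q : X -> cotangent X -> R) (H : cfield) : Prop :=
  forall i z, cdom O i z -> Char p i z -> Ham q i z = H i z.

(* [pt] is the smooth extension of q p^{-1} across Char P. *)
Definition extension (p : symbol) (O : X -> cotangent X -> Prop)
    (q : X -> cotangent X -> R) (pt : symbol) : Prop :=
  symbol_smooth_on O pt /\
  forall i z, cdom O i z -> ~ Char p i z ->
    pt (pnt i z.1) (cov i z) =
    (loc i q z)%:C *: (p (pnt i z.1) (cov i z))^-1%VF.

(* Char P is a smooth hypersurface with Hamilton field [H], i.e. around each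
   of its points it has a local defining function with Hamilton field [H];
   [H] is non-radial and invariant under dilations of the fibres. *)
Definition hypersurface_with_Hamilton_field (p : symbol) (H : cfield) : Prop :=
  [/\ forall i z, Char p i z -> exists O q,
        [/\ copen O, cdom O i z, defining p O q & Ham_on_Char p O q H],
      forall i z (c : R), Char p i z -> H i z <> (0, c *: z.2) &
      forall i z (t : R), Char p i z -> 0 < t ->
        H i (z.1, t *: z.2) = ((H i z).1, t *: (H i z).2)].

Definition real_principal_type (p : symbol) (H : cfield) : Prop :=
  [/\ hypersurface_with_Hamilton_field p H,
      forall i z, Char p i z ->
        \forall z' \near z, Char p i z' ->
          \dim (lker (p (pnt i z'.1) (cov i z'))) =
          \dim (lker (p (pnt i z.1) (cov i z))) &
      forall O q, copen O -> defining p O q -> exists pt, extension p O q pt].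

(* The functions [q] admitted for [P] endowed with the Hamilton field [H]. *)
Definition admissible (p : symbol) (H : cfield) (q : X -> cotangent X -> R) :
    Prop :=
  [/\ defining p (everywhere X) q,
      forall i z (t : R), img i z.1 -> z.2 != 0 -> 0 < t ->
        loc i q (z.1, t *: z.2) = t * loc i q z &
      Ham_on_Char p (everywhere X) q H].

End Operators.

Arguments symbol {R n N X} E.
Arguments cfield {R n} X.

(* Main.v *)
Require Import Defs.
From HB Require Import structures.
From mathcomp Require Import all_boot all_order all_algebra.
From mathcomp Require Import all_classical all_reals all_analysis.
From mathcomp Require Import complex.
From mathcomp Require Import ring lra.

(* Two admissible functions q, q' vanish on Char P together, with the same
   differential there, and the extensions pt, pt' of q p^-1, q' p^-1 satisfy
   q pt' = q' pt.  Differentiating this identity once shows that pt' = pt on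
   Char P.  Hence d(pt' - pt) vanishes on the tangent space of Char P, i.e. is a
   matrix multiple of dq, and differentiating a second time identifies it as
   c dq pt and the difference of the Hessians of q' and q as 2c dq (x) dq, with
   the same scalar c.  So q' never has to be divided by q.  On ker p the identity
   pt p = q gives pt (Hor p) = Hor q; therefore -i Vert pt . Hor p changes by
   -i c Vert q . Hor q, and (i/2) Vert . Hor q changes by i c Vert q . Hor q. *)

Set Implicit Arguments.
Unset Strict Implicit.
Unset Printing Implicit Defensive.

Import Order.TTheory GRing.Theory Num.Theory.
Import numFieldNormedType.Exports.

Local Open Scope classical_set_scope.
Local Open Scope ring_scope.
Local Open Scope complex_scope.

(** * Strict directional derivatives, and derivatives along a zero set *)

Section StrictDerivative.
Context {R : realType} {V : normedModType R}.
Implicit Types (f g : V -> R) (x z u v : V) (a b t : R).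

(* The base point [x] varies together with [t]: this is what makes the
   derivative additive in [v] without total differentiability. *)
Definition strict_derive f z v a : Prop :=
  forall e : R, 0 < e -> exists2 d : R, 0 < d &
    forall x t, `|x - z| < d -> `|t| < d ->
      `|f (x + t *: v) - f x - t * a| <= e * `|t|.

Lemma is_derive_line f x v t : derivable f (x + t *: v) v ->
  is_derive t 1 (fun s : R => f (x + s *: v)) ('D_v f (x + t *: v)).
Proof.
have E : (fun h : R => h^-1 *: (f (h *: v + (x + t *: v)) - f (x + t *: v))) =
         (fun h : R => h^-1 *: (f (x + (h *: (1 : R) + t) *: v) - f (x + t *: v))).
  apply/funext => h; congr (_ *: (f _ - _)).
  by rewrite scaler1 scalerDl addrCA.
move=> fd; split; first by move: fd; rewrite /derivable E.
by rewrite /derive E.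
Qed.

Lemma MVT_line f x v t :
  (forall s : R, `|s| <= `|t| -> derivable f (x + s *: v) v) ->
  exists2 c : R, `|c| <= `|t| &
    f (x + t *: v) - f x = t * 'D_v f (x + c *: v).
Proof.
move=> fd; pose F (s : R) : R := f (x + s *: v); pose dF s : R := 'D_v f (x + s *: v).
have FD (s : R) : `|s| <= `|t| -> is_derive s 1 F (dF s).
  by move=> st; apply/is_derive_line/fd.
have MVT (a b : R) : a <= b -> (forall s, s \in `[a, b] -> `|s| <= `|t|) ->
    exists2 c, c \in `[a, b] & F b - F a = dF c * (b - a).
  move=> ab st; apply: MVT_segment => // [s|].
    by move=> /subset_itv_oo_cc /st /FD.
  by apply: derivable_within_continuous => s /st /FD [].
have [t0|/ltW t0] := leP 0 t.
  have [s|c c0t] := MVT _ _ t0.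
    by rewrite in_itv/= => /andP[s0 st]; rewrite !ger0_norm.
  rewrite /F scale0r addr0 subr0 mulrC => ->; exists c => //.
  by move: c0t; rewrite in_itv/= => /andP[s0 st]; rewrite !ger0_norm.
have [s|c c0t] := MVT _ _ t0.
  by rewrite in_itv/= => /andP[s0 st]; rewrite !ler0_norm// lerN2.
rewrite /F scale0r addr0 sub0r => H; exists c.
  by move: c0t; rewrite in_itv/= => /andP[s0 st]; rewrite !ler0_norm// lerN2.
by rewrite -opprB H mulrN opprK mulrC.
Qed.

(** By the mean value theorem the increment from [x] to [x + t *: v] is [t] times a derivative at a
    point of that segment, which is close to ['D_v f z] by continuity, uniformly in [x]. *)
Lemma strict_derive_C1 f z v :
  (\forall x \near z, derivable f x v) -> {for z, continuous ('D_v f)} ->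
  strict_derive f z v ('D_v f z).
Proof.
move=> fd fc e e0.
have : \forall x \near z, derivable f x v /\ `|'D_v f x - 'D_v f z| < e.
  near=> x; split; first by near: x.
  by rewrite distrC; near: x; move/cvgrPdist_lt: fc => /(_ e e0).
move=> /nbhs_ballP[r /= r0 rP].
have v1 : 0 < 1 + `|v| by rewrite ltr_pwDl.
(* With this radius the whole segment stays in the ball of radius [r]: the base point moves by less
   than [r / (1 + |v|)] and the step adds at most [|v|] times that. *)
have d0 : 0 < r / (1 + `|v|) by rewrite divr_gt0.
exists (r / (1 + `|v|)) => // x t xz tr.
have inball (s : R) : `|s| <= `|t| -> ball z r (x + s *: v).
  move=> st; rewrite -ball_normE /= distrC addrAC.
  rewrite (le_lt_trans (ler_normD _ _))// normrZ.
  rewrite [ltRHS](_ : r = r / (1 + `|v|) + r / (1 + `|v|) * `|v|); last first.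
    by rewrite -[X in X + _]mulr1 -mulrDr divfK// gt_eqF.
  by rewrite ltr_leD// ler_wpM2r// (le_trans st)// ltW.
have [s st|c ct ->] := @MVT_line f x v t.
  by have [] := rP _ (inball s st).
rewrite -mulrBr normrM mulrC ler_wpM2r//.
by have [_ /ltW] := rP _ (inball c ct).
Unshelve. all: by end_near. Qed.

Lemma strict_derive_is_derive f z v a :
  strict_derive f z v a -> is_derive z v f a.
Proof.
move=> fa; suff lf : h^-1 *: (f (h *: v + z) - f z) @[h --> 0^'] --> a.
  by split; [apply/cvg_ex; exists a|exact: cvg_lim].
apply/cvgrPdist_le => e e0.
have [d d0 H] := fa e e0.
near=> h.
have h0 : h != 0 by near: h; exact: nbhs_dnbhs_neq.
have hd : `|h| < d.
  near: h; apply: dnbhs0_lt; exact: d0.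
have := H z h; rewrite subrr normr0 => /(_ d0 hd).
rewrite -ler_pdivrMr ?normr_gt0// -normfV -normrM => H'; apply: le_trans H'.
rewrite distrC /= [h *: v + z]addrC le_eqVlt; apply/orP; left; apply/eqP.
congr `|_|; rewrite -mulr_algl scaler1 /=; field.
by [].
Unshelve. all: by end_near. Qed.

(** The increment is taken in two stages, from [x] to [x + t *: u] and from there along [v]. The
    second stage starts at a moved base point, which the uniformity in [strict_derive] allows. *)
Lemma strict_deriveD f z u v a b : strict_derive f z u a ->
  strict_derive f z v b -> strict_derive f z (u + v) (a + b).
Proof.
move=> fa fb e e0; have e20 : 0 < e / 2 by rewrite divr_gt0.
have [d d0 Hd] := fa _ e20; have [r r0 Hr] := fb _ e20.
have u1 : 0 < 1 + `|u| by rewrite ltr_pwDl.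
have r'0 : 0 < r / (1 + `|u|) by rewrite divr_gt0.
have r'r : r / (1 + `|u|) <= r.
  by rewrite ler_pdivrMr// ler_peMr ?lerDl// ltW.
exists (Num.min d (r / (1 + `|u|))) => [|x t]; first by rewrite lt_min d0.
rewrite !lt_min => /andP[xd xr] /andP[td tr].
have xtu : `|x + t *: u - z| < r.
  rewrite addrAC (le_lt_trans (ler_normD _ _))// normrZ.
  rewrite [ltRHS](_ : r = r / (1 + `|u|) + r / (1 + `|u|) * `|u|); last first.
    by rewrite -[X in X + _]mulr1 -mulrDr divfK// gt_eqF.
  by rewrite ltr_leD// ler_wpM2r// ltW.
have h1 := Hd x t xd td.
have h2 := Hr _ t xtu (lt_le_trans tr r'r).
rewrite scalerDr addrA.
rewrite [X in `|X|](_ : _ = (f (x + t *: u + t *: v) - f (x + t *: u) - t * b)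
   + (f (x + t *: u) - f x - t * a)); last by ring.
rewrite (le_trans (ler_normD _ _))// (le_trans (lerD h2 h1))//.
by rewrite -mulrDl -splitr.
Qed.

Lemma strict_deriveZ f z v a c : strict_derive f z v a ->
  strict_derive f z (c *: v) (c * a).
Proof.
move=> fa e e0; have c1 : 0 < 1 + `|c| by rewrite ltr_pwDl.
have [d d0 Hd] := fa _ (divr_gt0 e0 c1).
have d'0 : 0 < d / (1 + `|c|) by rewrite divr_gt0.
have d'd : d / (1 + `|c|) <= d.
  by rewrite ler_pdivrMr// ler_peMr ?lerDl// ltW.
exists (d / (1 + `|c|)) => // x t xd td.
rewrite scalerA mulrA (le_trans (Hd _ _ _ _))//.
- exact: lt_le_trans d'd.
- rewrite normrM (@le_lt_trans _ _ (`|t| * (1 + `|c|)))//.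
    by rewrite ler_wpM2l// lerDr.
  by rewrite -ltr_pdivlMr.
- rewrite normrM -mulrA; apply: ler_wpM2l; first exact: ltW.
  by rewrite mulrCA ler_piMr// mulrC ler_pdivrMr// mul1r lerDr.
Qed.

Lemma strict_deriveB f g z v a b : strict_derive f z v a ->
  strict_derive g z v b -> strict_derive (fun x => f x - g x) z v (a - b).
Proof.
move=> fa gb e e0; have e20 : 0 < e / 2 by rewrite divr_gt0.
have [d d0 Hd] := fa _ e20; have [r r0 Hr] := gb _ e20.
exists (Num.min d r) => [|x t]; first by rewrite lt_min d0.
rewrite !lt_min => /andP[xd xr] /andP[td tr].
rewrite [X in `|X|](_ : _ = (f (x + t *: v) - f x - t * a)
   - (g (x + t *: v) - g x - t * b)); last by ring.
rewrite (le_trans (ler_normB _ _))//.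
by rewrite (le_trans (lerD (Hd _ _ xd td) (Hr _ _ xr tr)))// -mulrDl -splitr.
Qed.

Lemma strict_derive_sum f z (I : Type) (r : seq I) (v : I -> V) (a : I -> R) :
  (forall k, strict_derive f z (v k) (a k)) ->
  strict_derive f z (\sum_(k <- r) v k) (\sum_(k <- r) a k).
Proof.
move=> fa; elim: r => [|k r IH]; last first.
  by rewrite !big_cons; exact: strict_deriveD.
rewrite !big_nil => e e0; exists 1 => // x t _ _.
by rewrite scaler0 addr0 subrr mulr0 subrr normr0 mulr_ge0// ltW.
Qed.

(* The two values of [q] at [z + t (w -+ e v)] have opposite signs, so [q], and
   hence [h], vanishes in between; this bounds the derivative of [h] along the
   tangent vector [w] by a multiple of [e]. *)
Lemma derive_vanish q h z u v qu qv hu hv :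
  (\forall x \near z, {for x, continuous q}) ->
  (\forall x \near z, q x = 0 -> h x = 0) ->
  strict_derive q z u qu -> strict_derive q z v qv ->
  strict_derive h z u hu -> strict_derive h z v hv ->
  q z = 0 -> qv != 0 -> hu * qv = hv * qu.
Proof.
move=> qc qh dqu dqv dhu dhv qz qv0.
wlog qv_gt0 : v qv hv dqv dhv qv0 / 0 < qv.
  move=> wl; have [?|qvle] := ltP 0 qv; first exact: (wl v).
  have /(_ (- v) (- qv) (- hv)) := wl; rewrite !mulrN mulNr => H.
  apply: oppr_inj; apply: H; rewrite ?oppr_eq0//.
  - by rewrite -[- v]scaleN1r -(mulN1r qv); exact: strict_deriveZ.
  - by rewrite -[- v]scaleN1r -(mulN1r hv); exact: strict_deriveZ.
  - by rewrite oppr_gt0 lt_neqAle qv0.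
(* The derivative of [q] along [w] is 0, so [w] is tangent to the zero set; the claim says that the
   derivative [hw] of [h] along [w] is 0 as well. *)
pose w := qv *: u - qu *: v.
have dw f fu fv : strict_derive f z u fu -> strict_derive f z v fv ->
    strict_derive f z w (qv * fu - qu * fv).
  move=> du dv; rewrite /w -scaleNr -mulNr.
  by apply: strict_deriveD; exact: strict_deriveZ.
have dqw : strict_derive q z w 0.
  by have := dw q _ _ dqu dqv; rewrite mulrC subrr.
have dhw := dw h _ _ dhu dhv; clearbody w.
apply/eqP; rewrite -subr_eq0 mulrC [hv * _]mulrC.
move: dhw; set hw := qv * hu - qu * hv => dhw.
rewrite -normr_le0; apply/ler_addgt0Pl => e0 e00; rewrite addr0.
(* The final estimate bounds [|hw|] by [e * (|hv| + 2)]: one [e] for the error of [h] along [w], at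
   most one [e] for its error along [v], and [e * |hv|] for the displacement. *)
pose e := Num.min 1 (e0 / (`|hv| + 2)).
have hv2 : 0 < `|hv| + 2 by rewrite ltr_wpDl.
have e_gt0 : 0 < e by rewrite /e lt_min ltr01 divr_gt0.
have e_le1 : e <= 1 by rewrite /e ge_min lexx.
have ee0 : e * (`|hv| + 2) <= e0 by rewrite -ler_pdivlMr// /e ge_min lexx orbT.
(* Along [w + e *: v] and [w - e *: v] the derivatives of [q] are [e * qv] and its opposite; an
   error of half that size still fixes the sign of [q]. *)
have eqv0 : 0 < e * qv / 2 by rewrite divr_gt0// mulr_gt0.
have [d1 d10 H1] := strict_deriveD dqw (strict_deriveZ e dqv) eqv0.
have [d2 d20 H2] := strict_deriveD dqw (strict_deriveZ (- e) dqv) eqv0.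
have [d3 d30 H3] := dhw e e_gt0.
have [d4 d40 H4] := dhv e e_gt0.
have : \forall x \near z, {for x, continuous q} /\ (q x = 0 -> h x = 0).
  exact: filterI.
move=> /nbhs_ballP[r /= r0 rP].
(* [M] bounds the norm of [w + s *: v] for [|s| <= 1], and [m] is the smallest of the radii;
   [t = m / (2 M)] then keeps all points used below within [m] of [z]. *)
pose M := 1 + `|w| + `|v|.
have M0 : 0 < M by rewrite /M -addrA ltr_pwDl// addr_ge0.
have M1 : 1 <= M by rewrite /M -addrA lerDl addr_ge0.
pose m := Num.min r (Num.min (Num.min d1 d2) (Num.min d3 d4)).
have m0 : 0 < m by rewrite /m !lt_min r0 d10 d20 d30.
pose t := m / (M + M).
have t0 : 0 < t by rewrite divr_gt0// addr_gt0.
have tMm : t * M < m.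
  have MM := addr_gt0 M0 M0.
  by rewrite /t mulrAC ltr_pdivrMr// ltr_pM2l// ltrDl.
have tm : t < m.
  by apply: le_lt_trans tMm; rewrite ler_peMr// ltW.
have inball (s : R) : `|s| <= e -> `|t *: (w + s *: v)| < m.
  move=> se; apply: le_lt_trans tMm; rewrite normrZ gtr0_norm// ler_wpM2l ?(ltW t0)//.
  rewrite (le_trans (ler_normD _ _))// /M [1 + _]addrC -addrA lerD2l normrZ.
  by rewrite ler_wpDl// ler_piMl// (le_trans se).
have m_r : m <= r by rewrite /m ge_min lexx.
have [m1 m2 m3 m4] : [/\ m <= d1, m <= d2, m <= d3 & m <= d4].
  by rewrite /m !ge_min !lexx !orbT.
have inr (s : R) : `|s| <= e -> {for z + t *: (w + s *: v), continuous q} /\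
    (q (z + t *: (w + s *: v)) = 0 -> h (z + t *: (w + s *: v)) = 0).
  move=> se; apply: rP; rewrite -ball_normE /= opprD addrA subrr add0r normrN.
  exact: lt_le_trans (inball s se) m_r.
have t_norm : `|t| = t by rewrite gtr0_norm.
have zz : `|z - z| = 0 by rewrite subrr normr0.
have q1 : 0 <= q (z + t *: (w + e *: v)).
  have := H1 z t; rewrite zz t_norm => /(_ d10 (lt_le_trans tm m1)).
  rewrite qz subr0 add0r ler_norml => /andP[+ _].
  rewrite -[X in X <= _]/(- (_ * _)) => lb.
  have := mulr_gt0 t0 (mulr_gt0 e_gt0 qv_gt0); nra.
have q2 : q (z + t *: (w + (- e) *: v)) <= 0.
  have := H2 z t; rewrite zz t_norm => /(_ d20 (lt_le_trans tm m2)).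
  rewrite qz subr0 add0r ler_norml => /andP[_ ub].
  have := mulr_gt0 t0 (mulr_gt0 e_gt0 qv_gt0); nra.
have [] := @IVT R (fun s => q (z + t *: (w + s *: v))) (- e) e 0.
- by rewrite ge0_cp// ltW.
- apply: continuous_in_subspaceT => s; rewrite inE/= in_itv/= => se.
  have {}se : `|s| <= e by rewrite ler_norml.
  apply: (@continuous_comp R V R (fun s : R => z + t *: (w + s *: v)) q s); last first.
    by have [] := inr _ se.
  apply: cvgD; first exact: cvg_cst.
  apply: cvgZr; apply: cvgD; first exact: cvg_cst.
  by apply: cvgZl; exact: cvg_id.
- by rewrite ge_min le_max q1 q2 orbT.
move=> s; rewrite in_itv/= -ler_norml => se qs.
have [_ /(_ qs) hs] := inr s se.
have hz : h z = 0.
  have := rP z (ballxx _ r0); case=> _; exact.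
have h3 := H3 z t; rewrite zz t_norm in h3.
have {h3} := h3 d30 (lt_le_trans tm m3).
(* The step [t * s] along [v] leads from [z + t *: w] to the zero of [h] just found. Its base point
   depends on [t], hence the need for a strict derivative. *)
have := H4 (z + t *: w) (t * s).
have -> : z + t *: w + (t * s) *: v = z + t *: (w + s *: v).
  by rewrite -addrA scalerDr scalerA.
rewrite hs hz subr0 sub0r normrM t_norm => h4 h3.
have tw : `|z + t *: w - z| < d4.
  rewrite addrAC subrr add0r; have := inball 0.
  by rewrite normr0 scale0r addr0 => /(_ (ltW e_gt0))/lt_le_trans; exact.
have ts : t * `|s| < d4.
  by apply: le_lt_trans (lt_le_trans tm m4); rewrite ler_piMr ?(ltW t0)// (le_trans se).
have {}h4 := h4 tw ts.
have ts_e : t * `|s| <= t * e by rewrite ler_wpM2l ?(ltW t0).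
rewrite -(ler_pM2l t0) -[X in X * `|hw|]t_norm -normrM.
rewrite [X in `|X|](_ : _ = - (h (z + t *: w) - t * hw)
  - (- h (z + t *: w) - t * s * hv) - t * s * hv); last by ring.
rewrite (le_trans (ler_normB _ _))//.
rewrite (le_trans (lerD (ler_normB _ _) (lexx _)))// normrN.
rewrite (le_trans (lerD (lerD h3 h4) (lexx _)))//.
rewrite normrM normrM t_norm.
apply: (@le_trans _ _ (t * (e * (`|hv| + 2)))); last by rewrite ler_wpM2l ?(ltW t0).
have hv0 := normr_ge0 hv.
have te : t * e <= t by rewrite ler_piMr ?(ltW t0).
have s1 := normr_ge0 s.
nra.
Qed.

End StrictDerivative.

(** * Calculus of smooth functions on an open set *)

Section SmoothOn.
Context {R : realType} {V : normedModType R}.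
Implicit Types (A B : set V) (f g q b : V -> R) (x z u v : V).

Lemma smooth_on_sub A B f : B `<=` A -> smooth_on A f -> smooth_on B f.
Proof. by move=> BA fA vs v x /BA; exact: fA. Qed.

Lemma smooth_on_derivable A f x v : smooth_on A f -> A x -> derivable f x v.
Proof. by move=> fA Ax; have [] := fA [::] v x Ax. Qed.

Lemma smooth_on_continuous A f x : smooth_on A f -> A x ->
  {for x, continuous f}.
Proof. by move=> fA Ax; have [] := fA [::] 0 x Ax. Qed.

Lemma smooth_onD1 A f v : smooth_on A f -> smooth_on A ('D_v f).
Proof.
have E (vs : seq V) : Defs.iterD vs ('D_v f) = Defs.iterD (rcons vs v) f.
  by elim: vs => //= w vs ->.
by move=> fA vs u x Ax; rewrite E; exact: fA.
Qed.

Lemma smooth_on_strict A f z v : open A -> smooth_on A f -> A z ->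
  strict_derive f z v ('D_v f z).
Proof.
move=> oA fA Az; apply: strict_derive_C1; last first.
  exact: smooth_on_continuous (smooth_onD1 v fA) Az.
apply: filterS (open_nbhs_nbhs (conj oA Az)) => x Ax.
exact: smooth_on_derivable fA Ax.
Qed.

Lemma eq_on_derive A f g x v : open A -> A x -> (forall y, A y -> f y = g y) ->
  'D_v f x = 'D_v g x.
Proof.
move=> oA Ax fg; apply: near_eq_derive.
by apply: filterS (open_nbhs_nbhs (conj oA Ax)) => y /fg.
Qed.

Lemma derive_mul A f g x v : smooth_on A f -> smooth_on A g -> A x ->
  'D_v (fun y => f y * g y) x = 'D_v f x * g x + f x * 'D_v g x.
Proof.
move=> fA gA Ax.
rewrite (_ : (fun y => f y * g y) = f * g)// deriveM; last 2 first.
- exact: smooth_on_derivable fA Ax.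
- exact: smooth_on_derivable gA Ax.
by rewrite addrC mulrC.
Qed.

Lemma derive2_mul A f g x u v : open A -> smooth_on A f -> smooth_on A g ->
  A x ->
  'D_u ('D_v (fun y => f y * g y)) x =
  'D_u ('D_v f) x * g x + 'D_v f x * 'D_u g x
  + ('D_u f x * 'D_v g x + f x * 'D_u ('D_v g) x).
Proof.
move=> oA fA gA Ax; have fvA := smooth_onD1 v fA; have gvA := smooth_onD1 v gA.
rewrite (@eq_on_derive A _
  (fun y => 'D_v f y * g y + f y * 'D_v g y) x u oA Ax); last first.
  by move=> y Ay; exact: derive_mul Ay.
rewrite (_ : (fun y => _) = ('D_v f * g) + (f * 'D_v g))// deriveD; last 2 first.
- by apply: derivableM; [exact: smooth_on_derivable fvA Ax|
                         exact: smooth_on_derivable gA Ax].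
- by apply: derivableM; [exact: smooth_on_derivable fA Ax|
                         exact: smooth_on_derivable gvA Ax].
by rewrite (derive_mul _ fvA gA Ax) (derive_mul _ fA gvA Ax).
Qed.

(** If [b z] were nonzero, [b] would be nonzero near [z], so [q] would vanish near [z], against its
    nonzero derivative. This carries identities across Char P from its complement. *)
Lemma eq0_of_eq0_off_zeros A q b z v : open A -> A z ->
  {for z, continuous b} -> q z = 0 -> 'D_v q z != 0 ->
  (forall x, A x -> q x != 0 -> b x = 0) -> b z = 0.
Proof.
move=> oA Az bc qz qv0 H.
apply/eqP; apply/negPn/negP => bz0.
have bnear : \forall x \near z, b x != 0.
  by move: bc => /cvgr_neq0; exact.
have : \forall x \near z, q x = 0.
  have An := open_nbhs_nbhs (conj oA Az).
  near=> x; apply/eqP; apply/negPn/negP => qx0.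
  have /eqP bx : b x != 0 by near: x.
  by apply: bx; apply: H => //; near: x.
move=> qn.
have E : 'D_v q z = 'D_v (cst 0) z by exact: near_eq_derive.
by move: qv0; rewrite E derive_cst eqxx.
Unshelve. all: by end_near. Qed.

(** * The scalar identity [q b' = q' b], differentiated at zeros of [q] *)

Section Quotient.
Variables (A : set V) (q q' b b' : V -> R) (z : V).
Hypotheses (oA : open A) (Az : A z).
Hypotheses (qA : smooth_on A q) (qA' : smooth_on A q').
Hypotheses (bA : smooth_on A b) (bA' : smooth_on A b').
Hypothesis qb : forall x, A x -> q x * b' x = q' x * b x.
Hypothesis jet1 : forall x, A x -> q x = 0 ->
  [/\ q' x = 0, forall v, 'D_v q' x = 'D_v q x & exists v, 'D_v q x != 0].
Hypothesis qz : q z = 0.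

(** Where [q] and [q'] vanish, one derivative of [q b' = q' b] leaves
    ['D_v q x * b' x = 'D_v q x * b x], and [v] can be chosen with ['D_v q x] nonzero. *)
Lemma quotient_eq x : A x -> q x = 0 -> b' x = b x.
Proof.
move=> Ax qx; have [q'x q'v [v qv]] := jet1 Ax qx.
have := @eq_on_derive A _ _ x v oA Ax qb.
rewrite (derive_mul _ qA bA')// (derive_mul _ qA' bA)//.
by rewrite qx q'x q'v !mul0r !addr0; apply: mulfI.
Qed.

Let d v := 'D_v b' z - 'D_v b z.

(** By [quotient_eq] the function [b' - b] vanishes wherever [q] does, so its derivatives are
    proportional to those of [q]. *)
Lemma quotient_tangent u v : 'D_v q z != 0 -> d u * 'D_v q z = d v * 'D_u q z.
Proof.
move=> qv.
have db w : strict_derive (fun x => b' x - b x) z w (d w).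
  by apply: strict_deriveB; [exact: smooth_on_strict oA bA' Az|
                             exact: smooth_on_strict oA bA Az].
have An := open_nbhs_nbhs (conj oA Az).
apply: (@derive_vanish _ _ q (fun x => b' x - b x) z u v) => //.
- by apply: filterS An => x Ax; exact: smooth_on_continuous qA Ax.
- by apply: filterS An => x Ax qx; rewrite quotient_eq// subrr.
- exact: smooth_on_strict oA qA Az.
- exact: smooth_on_strict oA qA Az.
Qed.

(** This is the second derivative of [q b' = q' b]: the terms containing [q z] and [q' z] drop out,
    and the first derivatives of [q] and [q'] agree. *)
Lemma quotient_derive2 u v :
  'D_v q z * d u + 'D_u q z * d v =
  ('D_u ('D_v q') z - 'D_u ('D_v q) z) * b z.
Proof.
have [q'z q'v _] := jet1 Az qz.
have alg (q0 q0' b0 b0' Qu Qv Qu' Qv' Quv Quv' Bu Bv Bu' Bv' Buv Buv' : R) :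
    q0 = 0 -> q0' = 0 -> b0' = b0 -> Qu' = Qu -> Qv' = Qv ->
    Quv * b0' + Qv * Bu' + (Qu * Bv' + q0 * Buv') =
    Quv' * b0 + Qv' * Bu + (Qu' * Bv + q0' * Buv) ->
    Qv * (Bu' - Bu) + Qu * (Bv' - Bv) = (Quv' - Quv) * b0.
  by move=> -> -> -> -> -> H; lra.
apply: (alg _ _ _ _ _ _ _ _ _ _ _ _ _ _ _ _
  qz q'z (quotient_eq Az qz) (q'v u) (q'v v)).
apply: etrans (esym (derive2_mul u v oA qA bA' Az)) _.
apply: etrans _ (derive2_mul u v oA qA' bA Az).
apply: (eq_on_derive _ oA Az) => x Ax.
exact: (eq_on_derive _ oA Ax).
Qed.

(** The case [u = v] of [quotient_derive2] determines [d v], and [quotient_tangent] passes to [d w].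
    The factor in front of ['D_w q z * b z] involves only [q], [q'] and [v]. *)
Lemma quotient_derive1 v w : 'D_v q z != 0 ->
  'D_w b' z - 'D_w b z =
  ('D_v ('D_v q') z - 'D_v ('D_v q) z) / (2 * 'D_v q z ^+ 2) * 'D_w q z * b z.
Proof.
have alg (dw dv Qv Qw D b0 : R) : Qv != 0 -> dw * Qv = dv * Qw ->
    Qv * dv + Qv * dv = D * b0 -> dw = D / (2 * Qv ^+ 2) * Qw * b0.
  move=> Q0 h1 h2; apply: (mulIf Q0); rewrite h1.
  have -> : dv = D * b0 / (2 * Qv) by rewrite -h2; field.
  by field.
move=> qv; apply: (alg _ _ _ _ _ _ qv (quotient_tangent w qv)).
exact: quotient_derive2.
Qed.

(** Inserting [quotient_derive1] for [u] and [w] into [quotient_derive2] makes both sides multiples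
    of [b z], which is then cancelled. *)
Lemma quotient_hessian v u w : 'D_v q z != 0 -> b z != 0 ->
  'D_u ('D_w q') z - 'D_u ('D_w q) z =
  2 * (('D_v ('D_v q') z - 'D_v ('D_v q) z) / (2 * 'D_v q z ^+ 2))
    * 'D_u q z * 'D_w q z.
Proof.
have alg (Qu Qw du dw b0 c E : R) : b0 != 0 -> du = c * Qu * b0 ->
    dw = c * Qw * b0 -> Qw * du + Qu * dw = E * b0 -> E = 2 * c * Qu * Qw.
  by move=> bz -> -> H; apply: (mulIf bz); rewrite -H; ring.
move=> qv bz; apply: (alg _ _ _ _ _ _ _ bz (quotient_derive1 u qv)
  (quotient_derive1 w qv)).
exact: quotient_derive2.
Qed.

End Quotient.

End SmoothOn.

(** * Derivatives of complex matrix functions through real and imaginary parts *)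

Section ComplexMatrix.
Context {R : realType} {V : normedModType R}.

Lemma complexReD (x y : R[i]) : complex.Re (x + y) = complex.Re x + complex.Re y.
Proof. by case: x y => [? ?] []. Qed.

Lemma complexImD (x y : R[i]) : complex.Im (x + y) = complex.Im x + complex.Im y.
Proof. by case: x y => [? ?] []. Qed.

Lemma complexReM (x y : R[i]) : complex.Re (x * y) =
  complex.Re x * complex.Re y - complex.Im x * complex.Im y.
Proof. by case: x y => [? ?] []. Qed.

Lemma complexImM (x y : R[i]) : complex.Im (x * y) =
  complex.Re x * complex.Im y + complex.Im x * complex.Re y.
Proof. by case: x y => [? ?] []. Qed.

Lemma eq_ReIm (x y : R[i]) : complex.Re x = complex.Re y ->
  complex.Im x = complex.Im y -> x = y.
Proof. by case: x y => [? ?] [? ?] /= -> ->. Qed.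

Lemma Re_mulmx k l m (F : 'M[R[i]]_(k, l)) (G : 'M[R[i]]_(l, m)) a b :
  complex.Re ((F *m G) a b) =
  \sum_c (complex.Re (F a c) * complex.Re (G c b)
          - complex.Im (F a c) * complex.Im (G c b)).
Proof.
by rewrite mxE (big_morph _ complexReD (erefl : complex.Re (0 : R[i]) = 0));
  apply: eq_bigr => c _; rewrite complexReM.
Qed.

Lemma Im_mulmx k l m (F : 'M[R[i]]_(k, l)) (G : 'M[R[i]]_(l, m)) a b :
  complex.Im ((F *m G) a b) =
  \sum_c (complex.Re (F a c) * complex.Im (G c b)
          + complex.Im (F a c) * complex.Re (G c b)).
Proof.
by rewrite mxE (big_morph _ complexImD (erefl : complex.Im (0 : R[i]) = 0));
  apply: eq_bigr => c _; rewrite complexImM.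
Qed.

Lemma entrywise_impl k l (P Q : (V -> R) -> Prop) (F : V -> 'M[R[i]]_(k, l)) :
  (forall f, P f -> Q f) -> entrywise P F -> entrywise Q F.
Proof. by move=> PQ FP a b; have [/PQ ? /PQ] := FP a b. Qed.

Lemma Re_mulmx_fun k l m (F : V -> 'M[R[i]]_(k, l)) (G : V -> 'M[R[i]]_(l, m)) a b :
  (fun x => complex.Re ((F x *m G x) a b)) = \sum_c
    ((fun x => complex.Re (F x a c)) * (fun x => complex.Re (G x c b))
     - (fun x => complex.Im (F x a c)) * (fun x => complex.Im (G x c b))).
Proof. by apply/funext => x; rewrite Re_mulmx fct_sumE. Qed.

Lemma Im_mulmx_fun k l m (F : V -> 'M[R[i]]_(k, l)) (G : V -> 'M[R[i]]_(l, m)) a b :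
  (fun x => complex.Im ((F x *m G x) a b)) = \sum_c
    ((fun x => complex.Re (F x a c)) * (fun x => complex.Im (G x c b))
     + (fun x => complex.Im (F x a c)) * (fun x => complex.Re (G x c b))).
Proof. by apply/funext => x; rewrite Im_mulmx fct_sumE. Qed.

Lemma mxD_mul k l m (F : V -> 'M[R[i]]_(k, l)) (G : V -> 'M[R[i]]_(l, m)) z v :
  entrywise (fun f => derivable f z v) F ->
  entrywise (fun f => derivable f z v) G ->
  mxD v (fun x => F x *m G x) z = mxD v F z *m G z + F z *m mxD v G z.
Proof.
move=> dF dG; apply/matrixP => a b.
rewrite [LHS]mxE Re_mulmx_fun Im_mulmx_fun.
have dFr c := (dF a c).1; have dFi c := (dF a c).2.
have dGr c := (dG c b).1; have dGi c := (dG c b).2.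
rewrite !derive_sum => [|c|c]; last 2 first.
- by apply: derivableD; apply: derivableM.
- by apply: derivableB; apply: derivableM.
apply: eq_ReIm => /=.
- rewrite mxE complexReD !Re_mulmx -big_split/=; apply: eq_bigr => c _.
  rewrite deriveB; [|exact: derivableM..].
  by rewrite !deriveM// !mxE/= /GRing.scale/=; ring.
- rewrite mxE complexImD !Im_mulmx -big_split/=; apply: eq_bigr => c _.
  rewrite deriveD; [|exact: derivableM..].
  by rewrite !deriveM// !mxE/= /GRing.scale/=; ring.
Qed.

Lemma entrywise_continuous_mul k l m (F : V -> 'M[R[i]]_(k, l))
    (G : V -> 'M[R[i]]_(l, m)) z :
  entrywise (fun f => {for z, continuous f}) F ->
  entrywise (fun f => {for z, continuous f}) G ->
  entrywise (fun f => {for z, continuous f}) (fun x => F x *m G x).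
Proof.
move=> dF dG a b.
have dFr c := (dF a c).1; have dFi c := (dF a c).2.
have dGr c := (dG c b).1; have dGi c := (dG c b).2.
rewrite Re_mulmx_fun Im_mulmx_fun; split.
- elim/big_ind: _ => [|f g fc gc|c _]; first exact: cst_continuous.
    exact: continuousD.
  by apply: continuousB; exact: continuousM.
- elim/big_ind: _ => [|f g fc gc|c _]; first exact: cst_continuous.
    exact: continuousD.
  by apply: continuousD; exact: continuousM.
Qed.

Lemma mxD_scalar l (q : V -> R) z v :
  mxD v (fun x => ((q x)%:C%:M : 'M[R[i]]_l)) z = ('D_v q z)%:C%:M.
Proof.
apply/matrixP => a b; rewrite !mxE; have [ab|ab] := boolP (a == b).
  rewrite mulr1n (_ : (fun x => _) = q); last first.
    by apply/funext => x; rewrite mxE ab.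
  rewrite (_ : (fun x => complex.Im _) = cst 0) ?derive_cst//.
  by apply/funext => x; rewrite mxE ab.
rewrite mulr0n (_ : (fun x => _) = cst 0); last first.
  by apply/funext => x; rewrite mxE (negbTE ab).
rewrite (_ : (fun x => complex.Im _) = cst 0) ?derive_cst//.
by apply/funext => x; rewrite mxE (negbTE ab).
Qed.

Lemma eq_on_mxD k l (A : set V) (F G : V -> 'M[R[i]]_(k, l)) x v : open A ->
  A x -> (forall y, A y -> F y = G y) -> mxD v F x = mxD v G x.
Proof.
move=> oA Ax FG; apply/matrixP => a b; rewrite !mxE.
by congr (_ +i* _); apply: (eq_on_derive _ oA Ax) => y /FG ->.
Qed.

End ComplexMatrix.

(** * The comparison of [B'] with [B] for matrix functions *)

Section MatrixQuotient.
Context {R : realType} {V : normedModType R} {k l : nat}.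
Variables (U : set V) (q q' : V -> R) (B B' : V -> 'M[R[i]]_(k, l)) (z v : V).
Hypotheses (oU : open U) (Uz : U z).
Hypotheses (qU : smooth_on U q) (qU' : smooth_on U q').
Hypotheses (BU : entrywise (smooth_on U) B) (BU' : entrywise (smooth_on U) B').
Hypothesis qB : forall x, U x -> (q x)%:C *: B' x = (q' x)%:C *: B x.
Hypothesis jet1 : forall x, U x -> q x = 0 ->
  [/\ q' x = 0, forall v, 'D_v q' x = 'D_v q x & exists v, 'D_v q x != 0].
Hypothesis (qz : q z = 0) (qv : 'D_v q z != 0).

Let c := ('D_v ('D_v q') z - 'D_v ('D_v q) z) / (2 * 'D_v q z ^+ 2).

Lemma Re_qB x a b : U x ->
  q x * complex.Re (B' x a b) = q' x * complex.Re (B x a b).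
Proof.
move=> Ux; have /matrixP/(_ a b) := qB Ux; rewrite !mxE => /(congr1 (@complex.Re R)).
by rewrite !complexReM /= !mul0r !subr0.
Qed.

Lemma Im_qB x a b : U x ->
  q x * complex.Im (B' x a b) = q' x * complex.Im (B x a b).
Proof.
move=> Ux; have /matrixP/(_ a b) := qB Ux; rewrite !mxE => /(congr1 (@complex.Im R)).
by rewrite !complexImM /= !mul0r !addr0.
Qed.

Lemma mx_quotient_eq : B' z = B z.
Proof.
apply/matrixP => a b; have [Br Bi] := BU a b; have [Br' Bi'] := BU' a b.
apply: eq_ReIm.
  exact: (quotient_eq oU qU qU' Br Br' (fun x => @Re_qB x a b) jet1 Uz qz).
exact: (quotient_eq oU qU qU' Bi Bi' (fun x => @Im_qB x a b) jet1 Uz qz).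
Qed.

(** The scalar result applies to the real and imaginary part of every entry, always with the same
    [c], since [c] does not involve [B] or [B']. *)
Lemma mx_quotient_derive w :
  mxD w B' z - mxD w B z = (c * 'D_w q z)%:C *: B z.
Proof.
apply/matrixP => a b; have [Br Bi] := BU a b; have [Br' Bi'] := BU' a b.
rewrite !mxE; apply: eq_ReIm.
  rewrite complexReM/= mul0r subr0.
  exact: (quotient_derive1 oU Uz qU qU' Br Br' (fun x => @Re_qB x a b) jet1 qz w qv).
rewrite complexImM/= mul0r addr0.
exact: (quotient_derive1 oU Uz qU qU' Bi Bi' (fun x => @Im_qB x a b) jet1 qz w qv).
Qed.

(** Some entry of [B z] has a nonzero real or imaginary part, and the scalar result for that part
    suffices. *)
Lemma mx_quotient_hessian u w : B z != 0 ->
  'D_u ('D_w q') z - 'D_u ('D_w q) z = 2 * c * 'D_u q z * 'D_w q z.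
Proof.
move=> B0.
have [a [b Bab]] : exists a b, B z a b != 0.
  apply: contrapT => H; case/eqP: B0; apply/matrixP => a b; rewrite [RHS]mxE.
  by apply/eqP/negPn/negP => Bab; apply: H; exists a, b.
have [Br Bi] := BU a b; have [Br' Bi'] := BU' a b.
have [Re0|Re0] := eqVneq (complex.Re (B z a b)) 0; last first.
  exact: (quotient_hessian oU Uz qU qU' Br Br' (fun x => @Re_qB x a b) jet1 qz).
have Im0 : complex.Im (B z a b) != 0.
  by apply: contra Bab => /eqP Im0; apply/eqP; exact: eq_ReIm.
exact: (quotient_hessian oU Uz qU qU' Bi Bi' (fun x => @Im_qB x a b) jet1 qz).
Qed.

End MatrixQuotient.

(** * Endomorphisms of the fibres as matrices in a frame *)

Section Frames.
Context {R : realType} {n N : nat} {X : manifold R n} {E : bundle X N}.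
Implicit Types (j : triv E) (x : X).

Lemma fmx_app j x (f : 'End(fib E x)) w : tdom j x ->
  fmx j f *m fcrd j w = fcrd j (f w).
Proof.
move=> jx; have eB := frame_basis jx; apply/colP => k; rewrite !mxE.
rewrite [in RHS](coord_basis eB (memvf w)) !linear_sum; apply: eq_bigr => l _.
by rewrite !mxE !linearZ/= -tnth_nth mulrC.
Qed.

Lemma fmx_comp j x (f g : 'End(fib E x)) : tdom j x ->
  fmx j (g \o f)%VF = fmx j g *m fmx j f.
Proof.
move=> jx; apply/matrixP => k l.
have := fmx_app g (f (tnth (frame j x) l)) jx => /colP/(_ k).
rewrite !mxE comp_lfunE => <-; apply: eq_bigr => m _.
by rewrite !mxE.
Qed.

Lemma fmx1 j x : tdom j x -> fmx j (\1%VF : 'End(fib E x)) = 1%:M.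
Proof.
move=> jx; have eB := frame_basis jx; apply/matrixP => k l.
by rewrite !mxE id_lfunE (tnth_nth 0) coord_free ?(basis_free eB)// eq_sym.
Qed.

Lemma fmxZ j x a (f : 'End(fib E x)) : fmx j (a *: f) = a *: fmx j f.
Proof. by apply/matrixP => k l; rewrite !mxE !lfunE /= linearZ. Qed.

(** This links the determinant in [Char] to injectivity, under which [^-1%VF] is a genuine left
    inverse. *)
Lemma detE_lker x (f : 'End(fib E x)) : detE f != 0 -> lker f == 0%VS.
Proof.
move=> df; rewrite -subv0; apply/subvP => w; rewrite memv_ker memv0 => /eqP fw.
have eB := vbasisP {: fib E x}.
rewrite -(passmx.rVof_eq0 eB); apply/eqP.
have := passmx.rVof_app (vbasis {: fib E x}) eB f w; rewrite fw.
have -> : passmx.rVof (vbasis {: fib E x}) 0 = 0.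
  by apply/eqP; rewrite (passmx.rVof_eq0 eB).
have uf : passmx.mxof (vbasis {: fib E x}) (vbasis {: fib E x}) f \in unitmx.
  by rewrite unitmxE unitfE.
by move=> fw0; rewrite -(mulmxK uf (passmx.rVof _ w)) -fw0 mul0mx.
Qed.

End Frames.

(** * Directional derivatives in canonical coordinates *)

Section Coordinates.
Context {R : realType} {n : nat}.
Implicit Types z : 'rV[R]_n * 'rV[R]_n.

(** [smooth_on] speaks of each direction separately; linearity in [v] comes from the additivity of
    strict derivatives. *)
Lemma derive_coordinates A (f : 'rV[R]_n * 'rV[R]_n -> R) z v :
  open A -> smooth_on A f -> A z ->
  'D_v f z = \sum_k (v.1 0 k * 'D_(xdir k) f z)
           + \sum_k (v.2 0 k * 'D_(xidir k) f z).
Proof.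
move=> oA fA Az; apply: derive_val; apply: strict_derive_is_derive.
have E : v = \sum_k (v.1 0 k *: xdir k) + \sum_k (v.2 0 k *: xidir k).
  have fstD (I : finType) (F : I -> 'rV[R]_n * 'rV[R]_n) :
      \sum_k F k = (\sum_k (F k).1, \sum_k (F k).2).
    by apply: (big_ind3 (fun a b c => a = (b, c))) => [|a b c d e g -> ->|k _] //;
      exact: surjective_pairing.
  rewrite !fstD [LHS]surjective_pairing; congr pair => /=.
    rewrite [X in _ + X]big1 ?addr0; last by move=> k _; rewrite scaler0.
    exact: row_sum_delta.
  rewrite [X in X + _]big1 ?add0r; last by move=> k _; rewrite scaler0.
  exact: row_sum_delta.
rewrite [X in strict_derive _ _ X _]E.
by apply: strict_deriveD; apply: strict_derive_sum => k;
  apply: strict_deriveZ; exact: smooth_on_strict oA fA Az.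
Qed.

End Coordinates.

(** * Local expressions of [p], [q] and the extension of [q p^-1] *)

Section LocalCoordinates.
Context {R : realType} {n N : nat} {X : manifold R n} {E : bundle X N}.
Implicit Types (i : chart X) (j : triv E) (z : 'rV[R]_n * 'rV[R]_n).
Implicit Types (p pt : symbol E) (q : X -> cotangent X -> R).

Definition ldom i j : set ('rV[R]_n * 'rV[R]_n) :=
  [set z | cdom (everywhere X) i z /\ timg i j z.1].

Lemma timg_img i j y : timg i j y -> img i y /\ tdom j (pnt i y).
Proof. by move=> [x [ix jx] <-]; rewrite crdK//; split => //; exists x. Qed.

Lemma img_timg i j y : img i y -> tdom j (pnt i y) -> timg i j y.
Proof. by move=> [x ix <-]; rewrite crdK// => jx; exists x. Qed.

Lemma open_timg i j : open (timg i j).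
Proof.
rewrite openE => y /timg_img[iy jy]; rewrite /interior.
have n1 := open_nbhs_nbhs (conj (@crd_img_open _ _ X i) iy).
have n2 : \forall y' \near y, tdom j (pnt i y').
  by apply: (pnt_continuous iy); exact: open_nbhs_nbhs (conj (@tdom_open _ _ _ _ E j) jy).
apply: filterS2 n1 n2 => y'; exact: img_timg.
Qed.

Lemma open_ldom i j : open (ldom i j).
Proof.
rewrite openE => z [[iz z0 _] jz]; rewrite /interior.
have n1 : \forall z' \near z, timg i j z'.1.
  have c1 : fst @ z --> z.1 by exact: cvg_fst.
  apply: (c1 (timg i j)); exact: open_nbhs_nbhs (conj (@open_timg i j) jz).
have n2 : \forall z' \near z, z'.2 != 0.
  have c2 : snd @ z --> z.2 by exact: cvg_snd.
  by move/cvgr_neq0: c2; exact.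
apply: filterS2 n1 n2 => z' jz' z'0; split => //; split => //.
by have [] := timg_img jz'.
Qed.

Lemma lsym_ext p q pt i j z : extension p (everywhere X) q pt ->
  ldom i j z -> ~ Char p i z ->
  lsym pt i j z = (loc i q z)%:C *: fmx j (p (pnt i z.1) (cov i z))^-1%VF.
Proof. by move=> [_ ext] [cz jz] nz; rewrite /lsym ext// fmxZ. Qed.

(** Off Char P the inverse of [p] cancels. On Char P each entry of the difference of the two sides
    is continuous and vanishes where [q] does not, so [eq0_of_eq0_off_zeros] applies. *)
Lemma lsym_ext_mul p q pt i j z : symbol_smooth_on (everywhere X) p ->
  defining p (everywhere X) q -> extension p (everywhere X) q pt ->
  ldom i j z -> lsym pt i j z *m lsym p i j z = (loc i q z)%:C%:M.
Proof.
move=> ps dq ext.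
have off z' : ldom i j z' -> ~ Char p i z' ->
    lsym pt i j z' *m lsym p i j z' = (loc i q z')%:C%:M.
  move=> Uz nz; rewrite (lsym_ext ext Uz nz) -scalemxAl.
  have [[iz z0 _] /timg_img[_ jz]] := Uz.
  rewrite -fmx_comp// lker0_compVf ?fmx1// ?scalemx1//.
  by apply: detE_lker; apply/negP => /eqP d0; apply: nz.
move=> Uz; have [Cz|] := pselect (Char p i z); last exact: off.
have [qs /(_ z Uz.1)[qC /(_ Cz)[v qv]]] := dq i.
have qz := qC.2 Cz.
have cont a : entrywise (smooth_on (ldom i j)) (lsym a i j) ->
    entrywise (fun f => {for z, continuous f}) (lsym a i j).
  by apply: entrywise_impl => f fs; exact: smooth_on_continuous fs Uz.
have BA := entrywise_continuous_mul (cont _ (ext.1 i j)) (cont _ (ps i j)).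
have qU : smooth_on (ldom i j) (loc i q).
  by apply: smooth_on_sub qs => ? [].
apply/matrixP => a b; have [BAr BAi] := BA a b.
pose d : R := (a == b)%:R.
have ReD x : complex.Re (((loc i q x)%:C%:M : 'M[R[i]]_N) a b) = loc i q x * d.
  by rewrite mxE /d; case: (a == b); rewrite ?mulr1n ?mulr0n ?mulr1 ?mulr0.
have ImD x : complex.Im (((loc i q x)%:C%:M : 'M[R[i]]_N) a b) = 0.
  by rewrite mxE; case: (a == b); rewrite ?mulr1n ?mulr0n.
have nonC x : ldom i j x -> loc i q x != 0 -> ~ Char p i x.
  move=> Ux /eqP qx; have [_ /(_ x Ux.1)[qCx _]] := dq i.
  by move=> /qCx.
have qc := smooth_on_continuous qU Uz.
apply: eq_ReIm; apply/eqP; rewrite -subr_eq0; apply/eqP.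
- rewrite ReD.
  apply: (@eq0_of_eq0_off_zeros _ _ (ldom i j) (loc i q)
    (fun x => complex.Re ((lsym pt i j x *m lsym p i j x) a b) - loc i q x * d)
    z v (@open_ldom i j) Uz _ qz qv) => [|x Ux qx].
    by apply: continuousB => //; apply: continuousM => //; exact: cst_continuous.
  by rewrite off ?ReD ?subrr//; exact: nonC.
- rewrite ImD subr0.
  apply: (@eq0_of_eq0_off_zeros _ _ (ldom i j) (loc i q)
    (fun x => complex.Im ((lsym pt i j x *m lsym p i j x) a b))
    z v (@open_ldom i j) Uz _ qz qv) => [//|x Ux qx].
  by rewrite off ?ImD//; exact: nonC.
Qed.

(** On Char P both scalar factors are 0; off it both sides equal [q q' p^-1]. *)
Lemma lsym_ext_proportional p q q' pt pt' i j z :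
  defining p (everywhere X) q -> defining p (everywhere X) q' ->
  extension p (everywhere X) q pt -> extension p (everywhere X) q' pt' ->
  ldom i j z ->
  (loc i q z)%:C *: lsym pt' i j z = (loc i q' z)%:C *: lsym pt i j z.
Proof.
move=> dq dq' ext ext' Uz; have [Cz|nz] := pselect (Char p i z).
  have [_ /(_ z Uz.1)[/iffRL/(_ Cz) -> _]] := dq i.
  have [_ /(_ z Uz.1)[/iffRL/(_ Cz) -> _]] := dq' i.
  by rewrite !scale0r.
by rewrite (lsym_ext ext Uz nz) (lsym_ext ext' Uz nz) !scalerA mulrC.
Qed.

(** On Char P the Hamilton fields of [q] and [q'] are both [H], and their components are, up to
    sign, all the coordinate derivatives. *)
Lemma admissible_jet p (H : cfield X) q q' i j z :
  admissible p H q -> admissible p H q' -> ldom i j z -> loc i q z = 0 ->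
  [/\ loc i q' z = 0, forall v, 'D_v (loc i q') z = 'D_v (loc i q) z &
      exists v, 'D_v (loc i q) z != 0].
Proof.
move=> [dq _ Hq] [dq' _ Hq'] Uz qz.
have [qs /(_ z Uz.1)[qC qv]] := dq i.
have [qs' /(_ z Uz.1)[qC' _]] := dq' i.
have Cz := qC.1 qz; split; [exact: qC'.2|move=> v|exact: qv].
have sub : ldom i j `<=` cdom (everywhere X) i by move=> ? [].
have := Hq i z Uz.1 Cz; rewrite -(Hq' i z Uz.1 Cz) /Ham => -[e1 e2].
have D f : smooth_on (cdom (everywhere X) i) f -> 'D_v f z =
    \sum_k (v.1 0 k * 'D_(xdir k) f z) + \sum_k (v.2 0 k * 'D_(xidir k) f z).
  move=> /(smooth_on_sub sub) fs.
  exact: derive_coordinates v (@open_ldom i j) fs Uz.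
rewrite (D _ qs) (D _ qs').
congr (_ + _); apply: eq_bigr => k _; congr (_ * _).
  by move/oppr_inj/rowP: e2 => /(_ k); rewrite !mxE.
by move/rowP: e1 => /(_ k); rewrite !mxE.
Qed.

End LocalCoordinates.

(** * The contraction of vertical and horizontal derivatives *)

Section VerticalHorizontal.
Context {R : realType} {n : nat} {X : manifold R n} (nabla : connection X).
Implicit Types (i : chart X) (z : 'rV[R]_n * 'rV[R]_n).

(** Agreement on the line through [z] is enough, even if the functions differ at other points near
    [z]. *)
Lemma eq_line_derive (V : normedModType R) (f g : V -> R) (z v : V) :
  (forall h : R, f (h *: v + z) = g (h *: v + z)) -> 'D_v f z = 'D_v g z.
Proof.
move=> fg; have fz : f z = g z by have := fg 0; rewrite scale0r add0r.
rewrite /derive (_ : (fun h : R => h^-1 *: (f (h *: v + z) - f z)) =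
  fun h : R => h^-1 *: (g (h *: v + z) - g z))//.
by apply/funext => h; rewrite fg fz.
Qed.

Lemma is_derive_xi z (k j : 'I_n) :
  is_derive z (xidir k) (fun z' : 'rV[R]_n * 'rV[R]_n => z'.2 0 j) (j == k)%:R.
Proof.
apply: strict_derive_is_derive => e e0; exists 1 => // x t _ _.
by rewrite !mxE /= [X in X - _]addrAC subrr add0r subrr normr0 mulr_ge0// ltW.
Qed.

Lemma derive_hor (U : set ('rV[R]_n * 'rV[R]_n)) (q : X -> cotangent X -> R)
    i k z : smooth_on U (loc i q) -> U z ->
  'D_(xidir k) (hor nabla q i k) z =
  'D_(xidir k) ('D_(xdir k) (loc i q)) z
  + \sum_j \sum_m (chr nabla i z.1 j k m * (j == k)%:R * dxi q i m z
      + chr nabla i z.1 j k m * z.2 0 j *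
        'D_(xidir k) ('D_(xidir m) (loc i q)) z).
Proof.
move=> qU Uz.
have dq u v : is_derive z v ('D_u (loc i q)) ('D_v ('D_u (loc i q)) z).
  by apply: derivableP; exact: smooth_on_derivable (smooth_onD1 u qU) Uz.
pose G j m z' := chr nabla i z.1 j k m * (z'.2 0 j * dxi q i m z').
have dG j m : is_derive z (xidir k) (G j m)
    (chr nabla i z.1 j k m * ((j == k)%:R * dxi q i m z
     + z.2 0 j * 'D_(xidir k) ('D_(xidir m) (loc i q)) z)).
  have := is_deriveM (is_derive_xi z k j) (dq (xidir m) (xidir k)).
  move=> /(is_deriveZ (chr nabla i z.1 j k m)) D.
  apply: (is_derive_eq D).
  by rewrite /GRing.scale/= addrC [_ * (j == k)%:R]mulrC.
(* A vertical line keeps the base point, so the Christoffel symbols may be frozen at [z.1], as they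
   are in [G]. *)
rewrite (@eq_line_derive _ _ (fun z' => 'D_(xdir k) (loc i q) z'
    + \sum_j \sum_m G j m z')); last first.
  move=> h; rewrite /hor /= scaler0 add0r; congr (_ + _).
  by apply: eq_bigr => j _; apply: eq_bigr => m _; rewrite /G mulrA.
rewrite (_ : (fun z' => _) = 'D_(xdir k) (loc i q) + \sum_j \sum_m G j m);
  last first.
  apply/funext => z' /=; congr (_ + _); rewrite fct_sumE.
  by apply: eq_bigr => j _; rewrite fct_sumE.
have dS j := is_derive_sum (dG j).
have := is_deriveD (dq (xdir k) (xidir k)) (is_derive_sum dS).
move=> /@derive_val ->; congr (_ + _).
apply: eq_bigr => j _; apply: eq_bigr => m _; ring.
Qed.

(** Only the second derivatives change. Their increments share the factor [2 * c * dxi q i k z], and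
    what multiplies it adds up to [hor nabla q i k z]. *)
Lemma verhor_diff (U : set ('rV[R]_n * 'rV[R]_n))
    (q q' : X -> cotangent X -> R) (c : R) i z :
  smooth_on U (loc i q) -> smooth_on U (loc i q') -> U z ->
  (forall v, 'D_v (loc i q') z = 'D_v (loc i q) z) ->
  (forall u w, 'D_u ('D_w (loc i q')) z - 'D_u ('D_w (loc i q)) z =
    2 * c * 'D_u (loc i q) z * 'D_w (loc i q) z) ->
  verhor nabla q' i z = verhor nabla q i z
    + 2 * \sum_k (c * dxi q i k z * hor nabla q i k z).
Proof.
move=> qU qU' Uz dqq' hess; rewrite /verhor mulr_sumr -big_split/=.
apply: eq_bigr => k _; rewrite !(derive_hor _ _ Uz)//.
have {}hess u w : 'D_u ('D_w (loc i q')) z = 'D_u ('D_w (loc i q)) z +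
    2 * c * 'D_u (loc i q) z * 'D_w (loc i q) z.
  by rewrite -hess addrC subrK.
have HS : \sum_j \sum_m (chr nabla i z.1 j k m * (j == k)%:R * dxi q' i m z
      + chr nabla i z.1 j k m * z.2 0 j *
        'D_(xidir k) ('D_(xidir m) (loc i q')) z) =
    \sum_j \sum_m (chr nabla i z.1 j k m * (j == k)%:R * dxi q i m z
      + chr nabla i z.1 j k m * z.2 0 j *
        'D_(xidir k) ('D_(xidir m) (loc i q)) z)
    + 2 * c * dxi q i k z *
      \sum_j \sum_m chr nabla i z.1 j k m * z.2 0 j * dxi q i m z.
  rewrite mulr_sumr -big_split/=; apply: eq_bigr => j _.
  rewrite mulr_sumr -big_split/=; apply: eq_bigr => m _.
  rewrite (hess (xidir k) (xidir m)).
  have -> : dxi q' i m z = dxi q i m z by exact: dqq'.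
  rewrite -/(dxi q i k z) -/(dxi q i m z).
  by move: (dxi q i k z) (dxi q i m z) ('D_(xidir k) _ z) => *; ring.
apply: etrans (congr1 (fun s => _ + s) HS) _.
rewrite (hess (xidir k) (xdir k)) /hor -/(dxi q i k z) -/(dx q i k z).
move: (dxi q i k z) (dx q i k z) ('D_(xidir k) _ z) (\sum_j _) (\sum_j _) => *.
ring.
Qed.

End VerticalHorizontal.

(** * Horizontal derivatives of [p] on its kernel, and the cancellation *)

Section Subprincipal.
Context {R : realType} {n N : nat} {X : manifold R n} {E : bundle X N}.
Variables (nabla : connection X) (nablaE : bconnection E).
Variables (p pt : symbol E) (q : X -> cotangent X -> R).
Variables (i : chart X) (j : triv E) (z : 'rV[R]_n * 'rV[R]_n) (w : 'cV[R[i]]_N).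
Hypothesis ps : symbol_smooth_on (everywhere X) p.
Hypothesis dq : defining p (everywhere X) q.
Hypothesis ext : extension p (everywhere X) q pt.
Hypotheses (Uz : ldom (E := E) i j z) (qz : loc i q z = 0).
Hypothesis pw : lsym p i j z *m w = 0.

(** In the derivative of [pt p = q Id], the term in which [pt] is differentiated ends in [p] and so
    kills [w]. *)
Lemma lsym_ext_leibniz v :
  lsym pt i j z *m (mxD v (lsym p i j) z *m w) = ('D_v (loc i q) z)%:C *: w.
Proof.
have dd (a : symbol E) : symbol_smooth_on (everywhere X) a ->
    entrywise (fun f => derivable f z v) (lsym a i j).
  move=> /(_ i j); apply: entrywise_impl => f fs.
  exact: smooth_on_derivable fs Uz.
have := mxD_mul (dd _ ext.1) (dd _ ps).
rewrite (eq_on_mxD v (@open_ldom _ _ _ _ _ i j) Uz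
  (fun x Ux => lsym_ext_mul ps dq ext Ux)).
rewrite mxD_scalar => /(congr1 (mulmx^~ w)).
by rewrite mul_scalar_mx mulmxDl -!mulmxA pw mulmx0 add0r => ->.
Qed.

(** The commutator of the connection matrix with [p] contributes nothing: one term ends in
    [p w = 0], the other begins with [pt p = q Id = 0]. The remaining derivatives fall under
    [lsym_ext_leibniz]. *)
Lemma lsym_ext_horE k : lsym pt i j z *m (horE nabla nablaE p i j k z *m w) =
  (hor nabla q i k z)%:C *: w.
Proof.
have BA : lsym pt i j z *m lsym p i j z = 0.
  by rewrite (lsym_ext_mul ps dq ext Uz) qz; exact: (raddf0 (@scalar_mx _ N)).
rewrite /horE !mulmxDl !mulmxDr mulNmx mulmxN -mulmxA pw !mulmx0 sub0r.
rewrite -mulmxA [X in - X]mulmxA BA mul0mx oppr0 addr0.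
rewrite lsym_ext_leibniz /hor rmorphD scalerDl; congr (_ + _).
rewrite !rmorph_sum scaler_suml mulmx_suml mulmx_sumr; apply: eq_bigr => l _.
rewrite !rmorph_sum scaler_suml mulmx_suml mulmx_sumr; apply: eq_bigr => m _.
by rewrite -scalemxAl -scalemxAr lsym_ext_leibniz scalerA -rmorphM.
Qed.

End Subprincipal.

(** The two changes are [- i s] and [(i / 2) * 2 s], which add up to 0. *)
Lemma subprincipal_cancel (R : realType) N (A T T' : 'M[R[i]]_N)
    (w : 'cV[R[i]]_N) (h h' s : R) :
  T' *m w = T *m w + s%:C *: w -> h' = h + 2 * s ->
  (A - imC *: T + (imC / 2%:R * h%:C)%:M) *m w =
  (A - imC *: T' + (imC / 2%:R * h'%:C)%:M) *m w.
Proof.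
move=> Tw ->; rewrite !mulmxDl !mulNmx -!scalemxAl !mul_scalar_mx Tw.
rewrite -!addrA; congr (_ + _).
rewrite scalerDr opprD -addrA; congr (_ + _).
rewrite scalerA -scaleNr -scalerDl; congr (_ *: _).
rewrite rmorphD rmorphM/= rmorph_nat.
by field.
Qed.

(** * Independence of the choice of [q] *)

Theorem proposition5p1 (R : realType) (n N : nat) (X : manifold R n)
    (nabla : connection X) (E : bundle X N) (nablaE : bconnection E)
    (m : R) (P : tsection E -> tsection E) (p p1 : symbol E) (H : cfield X)
    (hP : Psi_phg nabla nablaE m P)
    (hp : leading_symbol nabla nablaE m P p p1)
    (hH : real_principal_type p H)
    (q q' : X -> cotangent X -> R)
    (hq : admissible p H q) (hq' : admissible p H q')
    (pt pt' : symbol E)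
    (hpt : extension p (everywhere X) q pt)
    (hpt' : extension p (everywhere X) q' pt')
    (i : chart X) (j : triv E) (z : 'rV[R]_n * 'rV[R]_n)
    (hz : Char p i z) (hj : tdom j (pnt i z.1))
    (w : fib E (pnt i z.1)) (hw : p (pnt i z.1) (cov i z) w = 0) :
  subprincipal nabla nablaE p p1 q pt i j z *m fcrd j w =
  subprincipal nabla nablaE p p1 q' pt' i j z *m fcrd j w.
Proof.
have ps : symbol_smooth_on (everywhere X) p.
  by have [ps [[sm _] <- _]] := hp; have [] := sm 0%N.
have Uz : ldom (E := E) i j z.
  by have [iz z0 _] := hz; split; [split|exact: img_timg].
have pw : lsym p i j z *m fcrd j w = 0.
  by rewrite fmx_app// hw; apply/colP => k; rewrite !mxE linear0.
have [dq _ _] := hq; have [dq' _ _] := hq'.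
have qz : loc i q z = 0 by have [_ /(_ z Uz.1)[/iffRL/(_ hz)]] := dq i.
have oU := @open_ldom _ _ _ _ E i j.
have sub : ldom (E := E) i j `<=` cdom (everywhere X) i by move=> ? [].
have qU := smooth_on_sub sub (dq i).1; have qU' := smooth_on_sub sub (dq' i).1.
have qB x := @lsym_ext_proportional _ _ _ _ _ p q q' pt pt' i j x dq dq' hpt hpt'.
have jet x := @admissible_jet _ _ _ _ _ p H q q' i j x hq hq'.
have [_ dqq' [v qv]] := jet z Uz qz.
have [w0|w0] := eqVneq (fcrd j w) 0.
  by move: (subprincipal _ _ _ _ q _ _ _ _) => S; rewrite w0 2!mulmx0.
(* If [pt] vanished at [z], [lsym_ext_leibniz] would give [('D_v q) w = 0] with both factors
   nonzero. A nonzero [pt] is what makes the Hessian comparison available. *)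
have B0 : lsym pt i j z != 0.
  apply: contra_neq w0 => B0.
  have := lsym_ext_leibniz ps dq hpt Uz pw v; rewrite B0 mul0mx => /esym/eqP.
  rewrite scaler_eq0 => /orP[/eqP[/eqP]|/eqP//].
  by rewrite (negbTE qv).
have BU := hpt.1 i j; have BU' := hpt'.1 i j.
have BB := mx_quotient_eq oU Uz qU qU' BU BU' qB jet qz.
have dB := mx_quotient_derive oU Uz qU qU' BU BU' qB jet qz qv.
have hess u y := mx_quotient_hessian oU Uz qU qU' BU BU' qB jet qz qv u y B0.
move: dB hess; set c := _ / _ => dB hess.
have dver := verhor_diff nabla qU qU' Uz dqq' hess.
(* Since [pt' = pt] at [z], the terms with [p1] agree; [dver] sets [s] to the sum of
   [c * dxi q i k z * hor nabla q i k z] over [k]. *)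
rewrite /subprincipal BB; apply: subprincipal_cancel dver.
rewrite !mulmx_suml rmorph_sum scaler_suml -big_split/=.
apply: eq_bigr => k _; rewrite -!mulmxA.
(* The vertical derivative of [pt'] is split into that of [pt] and a difference equal to
   [c * dxi q i k z] times [pt], to which [lsym_ext_horE] applies. *)
rewrite -(subrK (mxD (xidir k) (lsym pt i j) z) (mxD _ (lsym pt' i j) _)).
rewrite (dB (xidir k)) mulmxDl addrC -scalemxAl.
by rewrite (lsym_ext_horE _ _ ps dq hpt Uz qz pw) scalerA -rmorphM.
Qed.
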